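(* Let $n$ be a positive integer and let $\mathfrak{A}_n$ be a Banach ideal of $n$-homogeneous polynomials. Then there exist polynomial ideals $\mathfrak{A}_1,\dots,\mathfrak{A}_{n-1},\mathfrak{A}_{n+1},\dots$ (each $\mathfrak{A}_k$ an ideal of $k$-homogeneous polynomials) such that the infinite sequence $\{\mathfrak{A}_k\}_{k=1}^\infty$, with the given $\mathfrak{A}_n$ in position $n$, is a coherent sequence of polynomial ideals with coherence constants $C,D$ satisfying $1\le C,D\le e$. The polynomial ideals $\mathfrak{A}_1,\dots,\mathfrak{A}_{n-1}$ are uniquely determined by $\mathfrak{A}_n$.
   Context: All Banach spaces are complex. $\mathcal{L}(E,F)$ is the Banach space of continuous linear operators from $E$ to $F$ and $\mathcal{P}^k(E,F)$ is the Banach space of continuous $k$-homogeneous polynomials from $E$ to $F$ (sup norm on the unit ball). For $P\in\mathcal{P}^k(E,F)$, $\overset{\vee}{P}$ is the unique symmetric $k$-linear map with $P(x)=\overset{\vee}{P}(x,\dots,x)$, and for $a\in E$, $P_a\in\mathcal{P}^{k-1}(E,F)$ is defined by $P_a(x)=\overset{\vee}{P}(a,x,\dots,x)$. For $\gamma\in E'$ and $P\in\mathcal{P}^k(E,F)$, $\gamma P$ is the $(k+1)$-homogeneous polynomial $x\mapsto\gamma(x)P(x)$. A normed ideal of continuous $k$-homogeneous polynomials is a pair $(\mathfrak{A}_k,\|\cdot\|_{\mathfrak{A}_k})$ such that: (i) for all Banach spaces $E,F$, $\mathfrak{A}_k(E,F)=\mathfrak{A}_k\cap\mathcal{P}^k(E,F)$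 is a linear subspace of $\mathcal{P}^k(E,F)$ and $\|\cdot\|_{\mathfrak{A}_k(E,F)}$ is a norm on it; (ii) if $T\in\mathcal{L}(E_1,E)$, $P\in\mathfrak{A}_k(E,F)$, $S\in\mathcal{L}(F,F_1)$, then $S\circ P\circ T\in\mathfrak{A}_k(E_1,F_1)$ and $\|S\circ P\circ T\|_{\mathfrak{A}_k(E_1,F_1)}\le\|S\|\,\|P\|_{\mathfrak{A}_k(E,F)}\|T\|^k$; (iii) $z\mapsto z^k$ belongs to $\mathfrak{A}_k(\mathbb{C},\mathbb{C})$ and has norm $1$. It is a Banach ideal if every $\mathfrak{A}_k(E,F)$ is complete in its norm. Coherence: a sequence $\{\mathfrak{A}_k\}_{k=1}^N$ ($N$ possibly infinite), with each $\mathfrak{A}_k$ an ideal of $k$-homogeneous polynomials, is a coherent sequence of polynomial ideals if there exist positive constants $C,D$ such that for all Banach spaces $E,F$ and all $k=1,\dots,N-1$ (all $k\ge 1$ if $N=\infty$): (i) for each $P\in\mathfrak{A}_{k+1}(E,F)$ and $a\in E$, $P_a\in\mathfrak{A}_k(E,F)$ and $\|P_a\|_{\mathfrak{A}_k(E,F)}\le C\|P\|_{\mathfrak{A}_{k+1}(E,F)}\|a\|$; (ii) for each $P\in\mathfrak{A}_k(E,F)$ and $\gamma\in E'$, $\gamma P\in\mathfrak{A}_{k+1}(E,F)$ and $\|\gamma P\|_{\mathfrak{A}_{k+1}(E,F)}\le D\|\gamma\|\,\|P\|_{\mathfrak{A}_k(E,F)}$.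
   Formalization: The uniqueness of the ideals of degree 1 to n-1 is stated as equality of the classes of polynomials with equivalent norms (constants uniform over all Banach spaces), since literal equality of the ideal norms fails in general. *)

(* Defs.v *)
From HB Require Import structures.
From mathcomp Require Import all_boot all_order all_algebra all_fingroup.
From mathcomp Require Import all_classical all_reals all_analysis.
From mathcomp Require Import complex.

Set Implicit Arguments.
Unset Strict Implicit.
Unset Printing Implicit Defensive.

Import Order.TTheory GRing.Theory Num.Theory numFieldNormedType.Exports.

Local Open Scope classical_set_scope.
Local Open Scope ring_scope.

(* The library does not provide the complex numbers [R[i]] as a Banach space
   over themselves. *)
HB.instance Definition _ (R : realType) := NormedModule.copy R[i] R[i]^o.

Lemma complex_complete (R : realType) (F : set_system R[i]) :
  ProperFilter F -> cauchy F -> cvg F.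
Proof.
move=> FF /cauchyP cF.
have le_part (p : R[i] -> R) : (forall x y, p (x - y) = p x - p y) ->
    (forall x, `|p x|%:C%C <= `|x|) -> cvg (p @ F).
  move=> pB ple; apply: R_complete; apply/cauchyP => e e0.
  have [|x Fx] := cF e%:C%C; first by rewrite ltcR.
  exists (p x); rewrite /nbhs /=; apply: filterS Fx => y; rewrite /ball /= => xy.
  by rewrite -pB -ltcR; apply: le_lt_trans (ple _) xy.
have RF : cvg (@complex.Re R @ F).
  by apply: le_part => [[? ?] [? ?]//|x]; exact: normc_ge_Re.
have IF : cvg (@complex.Im R @ F).
  apply: le_part => [[? ?] [? ?]//|[a b]] /=.
  by rewrite normc_def lecR /= -sqrtr_sqr ler_wsqrtr // lerDr sqr_ge0.
apply/cvg_ex; exists (Complex (lim (@complex.Re R @ F)) (lim (@complex.Im R @ F))).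
apply/cvgrPdist_lt => -[e e'] /= e0.
have [e'0 {}e0] : e' = 0 /\ 0 < e.
  by move: e0; rewrite ltcE /= => /andP[/eqP].
subst e'; have e20 : 0 < e / 2 by rewrite divr_gt0.
move/cvgrPdist_lt : (RF) => /(_ _ e20) nR.
move/cvgrPdist_lt : (IF) => /(_ _ e20) nI.
near=> z.
have zR : `|lim (@complex.Re R @ F) - complex.Re z| < e / 2 by near: z.
have zI : `|lim (@complex.Im R @ F) - complex.Im z| < e / 2 by near: z.
rewrite (_ : _ - z = (lim (@complex.Re R @ F) - complex.Re z)%:C%C
    + Complex 0 1 * (lim (@complex.Im R @ F) - complex.Im z)%:C%C); last first.
  by rewrite {1}(complexE z); simpc.
rewrite (_ : Complex e 0 = (e / 2)%:C%C + (e / 2)%:C%C); last first.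
  by rewrite -rmorphD /= -splitr.
apply: le_lt_trans (ler_normD _ _) _; rewrite normrM.
have -> : `|Complex 0 1 : R[i]| = 1.
  by rewrite normc_def /= expr0n /= add0r expr1n sqrtr1.
rewrite mul1r; apply: ltrD; rewrite normc_def /= expr0n /= addr0 sqrtr_sqr ltcR //.
Unshelve. all: by end_near. Qed.

HB.instance Definition _ (R : realType) :=
  Uniform_isComplete.Build R[i] (@complex_complete R).

Section Defs.
Variable R : realType.

Local Notation banach := (completeNormedModType R[i]).

(* Norms of normed modules over [R[i]] take their values in [R[i]]; this is the
   same norm, seen as a real number. *)
Definition rnorm (V : normedModType R[i]) (x : V) : R := complex.Re `|x|.

Definition opnorm (V W : normedModType R[i]) (f : V -> W) : R :=
  sup [set rnorm (f x) | x in [set x : V | rnorm x <= 1]].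

Definition multilinear (k : nat) (E F : lmodType R[i])
    (M : ('I_k -> E) -> F) : Prop :=
  forall (i : 'I_k) (x : 'I_k -> E) (a : R[i]) (u v : E),
    M (dfwith x i (a *: u + v)) = a *: M (dfwith x i u) + M (dfwith x i v).

Definition symmetric_map (k : nat) (E F : lmodType R[i])
    (M : ('I_k -> E) -> F) : Prop :=
  forall (s : 'S_k) (x : 'I_k -> E), M (x \o s) = M x.

Definition polar_of (k : nat) (E F : lmodType R[i]) (P : E -> F) :
    set (('I_k -> E) -> F) :=
  [set M | [/\ multilinear M, symmetric_map M & forall x, P x = M (fun=> x)]].

Definition cpoly (k : nat) (E F : banach) : set (E -> F) :=
  [set P | continuous P /\ exists M, @polar_of k E F P M].

(* The symmetric [k]-linear map of a [k]-homogeneous polynomial; it is unique by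
   the polarization formula, and the default value is irrelevant. *)
Definition polar (k : nat) (E F : banach) (P : E -> F) : ('I_k -> E) -> F :=
  xget (fun=> 0) (polar_of P).

(* [P_a], for [P] homogeneous of degree [k.+1]. *)
Definition polder (k : nat) (E F : banach) (P : E -> F) (a : E) : E -> F :=
  fun x => polar P (fun i : 'I_k.+1 => if i == ord0 then a else x).

Definition mulfunctional (E F : banach) (g : E -> R[i]) (P : E -> F) : E -> F :=
  fun x => g x *: P x.

(* A class of maps between Banach spaces, with a real number attached to each of
   them; [inorm] is meaningful only on the members of the class. *)
Record polyclass := PolyClass {
  mem_class :> forall E F : banach, set (E -> F);
  inorm : forall E F : banach, (E -> F) -> R
}.

Definition normed_subspace (k : nat) (A : polyclass) (E F : banach) : Prop :=
  [/\ A E F `<=` @cpoly k E F,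
      A E F 0,
      forall (a : R[i]) (P Q : E -> F),
        A E F P -> A E F Q -> A E F (a *: P + Q) &
      [/\ forall P : E -> F, A E F P -> 0 <= inorm A P,
          forall P : E -> F, A E F P -> inorm A P = 0 -> P = 0,
          forall (a : R[i]) (P : E -> F),
            A E F P -> inorm A (a *: P) = rnorm a * inorm A P &
          forall P Q : E -> F, A E F P -> A E F Q ->
            inorm A (P + Q) <= inorm A P + inorm A Q]].

Definition normed_ideal (k : nat) (A : polyclass) : Prop :=
  [/\ forall E F : banach, normed_subspace k A E F,
      forall (E1 E F F1 : banach)
             (T : {linear E1 -> E}) (P : E -> F) (S : {linear F -> F1}),
        continuous T -> continuous S -> A E F P ->
        A E1 F1 (S \o P \o T) /\
        inorm A (S \o P \o T) <= opnorm S * inorm A P * opnorm T ^+ k &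
      A R[i] R[i] (fun z : R[i] => z ^+ k) /\
      inorm A (fun z : R[i] => z ^+ k) = 1].

Definition complete_class (A : polyclass) : Prop :=
  forall (E F : banach) (u : nat -> E -> F),
    (forall m, A E F (u m)) ->
    (forall eps : R, 0 < eps -> exists m0, forall p q,
       (m0 <= p)%N -> (m0 <= q)%N -> inorm A (u p - u q) < eps) ->
    exists P : E -> F,
      A E F P /\ (fun m => inorm A (u m - P)) @ \oo --> (0 : R).

Definition banach_ideal (k : nat) (A : polyclass) : Prop :=
  normed_ideal k A /\ complete_class A.

(* The indices of a sequence of length [N], numbered from 1; [None] stands for
   an infinite length. *)
Definition index_in (N : option nat) (k : nat) : bool :=
  (0 < k)%N && (if N is Some m then (k <= m)%N else true).

Definition coherent_with (C D : R) (N : option nat) (A : nat -> polyclass) :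
    Prop :=
  [/\ forall k, index_in N k -> normed_ideal k (A k),
      forall (k : nat) (E F : banach) (P : E -> F) (a : E),
        index_in N k -> index_in N k.+1 -> A k.+1 E F P ->
        A k E F (polder k P a) /\
        inorm (A k) (polder k P a) <= C * inorm (A k.+1) P * rnorm a &
      forall (k : nat) (E F : banach) (P : E -> F) (g : {linear E -> R[i]}),
        index_in N k -> index_in N k.+1 -> continuous g -> A k E F P ->
        A k.+1 E F (mulfunctional g P) /\
        inorm (A k.+1) (mulfunctional g P) <= D * opnorm g * inorm (A k) P].

Definition coherent (N : option nat) (A : nat -> polyclass) : Prop :=
  exists C D : R, [/\ 0 < C, 0 < D & coherent_with C D N A].

Definition same_ideal (A B : polyclass) : Prop :=
  forall E F : banach, A E F = B E F /\
    forall P : E -> F, A E F P -> inorm A P = inorm B P.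

(* Same members, with norms equivalent uniformly over all Banach spaces. *)
Definition equivalent_ideal (A B : polyclass) : Prop :=
  (forall E F : banach, A E F = B E F) /\
  exists c d : R, [/\ 0 < c, 0 < d &
    forall (E F : banach) (P : E -> F), A E F P ->
      c * inorm A P <= inorm B P <= d * inorm A P].

End Defs.

(* Main.v *)
Require Import Defs.
From HB Require Import structures.
From mathcomp Require Import all_boot all_order all_algebra all_fingroup all_field.
From mathcomp Require Import all_classical all_reals all_analysis.
From mathcomp Require Import cyclic complex ring.

Set Implicit Arguments.
Unset Strict Implicit.
Unset Printing Implicit Defensive.

Import Order.TTheory GRing.Theory Num.Theory numFieldNormedType.Exports.

Local Open Scope classical_set_scope.
Local Open Scope ring_scope.

(** Above degree n, take A_(k+1) to be the class of all P whose derivatives P_a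
lie in A_k, with norm sup {|P_a| : |a| <= 1}.  Below degree n, take A_k to be
the class of all P for which (x, z) |-> z P(x) lies in A_(k+1) (E x C, F), with
the norm of that polynomial divided by the norm of (z, w) |-> w z^k.  Both
coherence estimates follow from one bound: if T, U are linear with |T| <= 1 and
|U| <= u, then x |-> Q^(U x, T x, ..., T x) has norm at most
u (1 + 1/k)^k |Q| <= e u |Q|, where Q^ is the polar form of Q, of degree k+1.
Uniqueness below n holds because P is k+1 times the derivative of z P(x) in the
direction (0, 1), restricted to E x 0. *)

HB.saturate prod.

(** An ideal norm is controlled only under linear combinations and under composition with linear
    maps. A mixed value Q^(U x, T x, ..., T x) is of neither kind, so it is recovered as a finite
    linear combination of compositions of Q with the linear maps T + s w^j U, where w is a root of
    unity; unlike a Cauchy integral, a finite sum makes sense in a class whose norm is not known to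
    be complete. The resulting bound is (1 + s u)^(k+1) / ((k+1) s) times |Q|, and s = 1/(k u) turns
    it into u (1 + 1/k)^k. Below degree n, coherence forces g P into A_(k+1) for every functional g.
    The polynomial z P(x) represents all these products at once: for the maximum norm on E x C the
    map x |-> (x, g(x)/|g|) has norm at most 1 and carries z P(x) to g P / |g|. The norm is
    therefore that of a single polynomial instead of a supremum over g, and the vector space and
    norm axioms pass directly from A_(k+1) to A_k. *)

Lemma prod_complete (K : numFieldType) (E F : completeNormedModType K)
    (G : set_system (E * F)%type) :
  ProperFilter G -> cauchy G -> cvg G.
Proof.
move=> GG /cauchyP cG.
have c1 : cvg (fst @ G).
  apply: cauchy_cvg; apply/cauchyP => e e0; have [p Gp] := cG e e0.
  by exists p.1; rewrite /nbhs /=; apply: filterS Gp => q [].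
have c2 : cvg (snd @ G).
  apply: cauchy_cvg; apply/cauchyP => e e0; have [p Gp] := cG e e0.
  by exists p.2; rewrite /nbhs /=; apply: filterS Gp => q [].
apply/cvg_ex; exists (lim (fst @ G), lim (snd @ G)).
have h := cvg_pair c1 c2.
by move=> A /h; rewrite /fmap /nbhs /=; apply: filterS => -[].
Qed.

(** Ideals are evaluated on Banach spaces only, and the classes below degree n evaluate the next one
    on E x C. *)
HB.instance Definition _ (K : numFieldType) (E F : completeNormedModType K) :=
  Uniform_isComplete.Build (E * F)%type (@prod_complete K E F).

(** X^n - 1 splits and is separable in characteristic zero, so it has n distinct roots, and n
    distinct n-th roots of unity include a primitive one. *)
Lemma closed_field_prim_root (K : numClosedFieldType) (n : nat) :
  (0 < n)%N -> exists z : K, n.-primitive_root z.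
Proof.
pose p : {poly K} := 'X^n - 1; have [r Dp] := closed_field_poly_normal p.
move=> n_gt0; rewrite (monicP _) ?monicXnsubC // scale1r in Dp.
have rn1: all n.-unity_root r by apply/allP=> z; rewrite -root_prod_XsubC -Dp.
have sz_r: (n < (size r).+1)%N.
  by rewrite -(size_prod_XsubC r id) -Dp size_XnsubC.
have [|z] := hasP (has_prim_root n_gt0 rn1 _ sz_r); last by exists z.
by rewrite -separable_prod_XsubC -Dp separable_Xn_sub_1 // pnatr_eq0 -lt0n.
Qed.

(** * Real-valued norms and operator norms *)

Section RealNorm.
Variable R : realType.
Implicit Types V W : normedModType R[i].

Lemma rnormE V (x : V) : `|x| = (rnorm x)%:C%C.
Proof.
have := normr_ge0 x.
by rewrite /rnorm; move: (`|x|) => -[a b]; rewrite lecE /= => /andP[/eqP-> _].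
Qed.

Lemma rnorm_ge0 V (x : V) : 0 <= rnorm x.
Proof. by rewrite -lecR -rnormE; exact: normr_ge0. Qed.

Lemma rnorm0 V : rnorm (0 : V) = 0.
Proof. by rewrite /rnorm normr0. Qed.

Lemma rnorm_eq0 V (x : V) : (rnorm x == 0) = (x == 0).
Proof. by rewrite -(normr_eq0 x) rnormE (inj_eq (@complexI _)). Qed.

Lemma ler_rnormD V (x y : V) : rnorm (x + y) <= rnorm x + rnorm y.
Proof. by rewrite -lecR rmorphD /= -!rnormE ler_normD. Qed.

Lemma rnormZ V (a : R[i]) (x : V) : rnorm (a *: x) = rnorm a * rnorm x.
Proof. by apply: (@complexI R); rewrite rmorphM /= -!rnormE normrZ. Qed.

Lemma rnormM (a b : R[i]) : rnorm (a * b) = rnorm a * rnorm b.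
Proof. exact: rnormZ a b. Qed.

Lemma rnorm_real (a : R) : rnorm (a%:C%C) = `|a|.
Proof. by rewrite /rnorm normc_def /= expr0n addr0 sqrtr_sqr. Qed.

Lemma rnorm1 : rnorm (1 : R[i]) = 1.
Proof. by rewrite (rnorm_real 1) normr1. Qed.

Lemma rnorm_nat n : rnorm (n%:R : R[i]) = n%:R.
Proof. by rewrite -(rmorph_nat (real_complex R)) rnorm_real normr_nat. Qed.

Lemma rnormX (a : R[i]) n : rnorm (a ^+ n) = rnorm a ^+ n.
Proof. by elim: n => [|n IH]; rewrite ?rnorm1 // !exprS rnormM IH. Qed.

Lemma rnormV (a : R[i]) : rnorm a^-1 = (rnorm a)^-1.
Proof. by apply: (@complexI R); rewrite -rnormE normfV rnormE fmorphV. Qed.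

Lemma rnorm_pair V W (p : V * W) : rnorm p = Num.max (rnorm p.1) (rnorm p.2).
Proof.
apply: (@complexI R); rewrite -rnormE prod_normE !rnormE.
by rewrite /Order.max ltcR; case: ifP.
Qed.

Lemma rnorm_fst V W (p : V * W) : rnorm p.1 <= rnorm p.
Proof. by rewrite rnorm_pair le_max lexx. Qed.

Lemma rnorm_snd V W (p : V * W) : rnorm p.2 <= rnorm p.
Proof. by rewrite rnorm_pair le_max lexx orbT. Qed.

Lemma rnorm_prim_root n (w : R[i]) : n.-primitive_root w -> rnorm w = 1.
Proof.
move=> wP; have n0 := prim_order_gt0 wP.
have := prim_expr_order wP => /(congr1 (@rnorm R _)).
by rewrite rnormX rnorm1 => /eqP; rewrite pexprn_eq1 ?rnorm_ge0// gtn_eqF//= => /eqP.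
Qed.

Lemma bounded_continuous V W (f : V -> W) (c : R) :
  linear f -> (forall x, rnorm (f x) <= c * rnorm x) -> continuous f.
Proof.
move=> fl fc; pose g : {linear V -> W} := HB.pack f (GRing.isLinear.Build _ _ _ _ f fl).
suff : continuous g by [].
apply/linear_bounded_continuous/linear_boundedP; exists c%:C%C; split.
  by rewrite complex_real.
move=> r cr x; apply: (@le_trans _ _ (c%:C%C * `|x|)); last first.
  by rewrite ler_wpM2r // ltW.
by rewrite !rnormE -rmorphM lecR fc.
Qed.

Lemma has_sup_opnorm V W (f : {linear V -> W}) :
  continuous f -> has_sup [set rnorm (f x) | x in [set x : V | rnorm x <= 1]].
Proof.
move=> fc; have /linear_boundedP[r [rr rb]] := (linear_bounded_continuous f).2 fc.
split; first by exists 0, 0; rewrite /= ?linear0 ?rnorm0.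
(* Boundedness gives an estimate only for constants strictly above [r], hence the 1; the maximum
   keeps [s] nonnegative, so that |y| <= 1 absorbs the factor |y|. *)
pose s : R := Num.max 0 (complex.Re r) + 1.
exists s => _ [y /= y1 <-].
have rs : r < s%:C%C.
  have -> : r = (complex.Re r)%:C%C by rewrite RRe_real.
  by rewrite ltcR /s (le_lt_trans (y := Num.max 0 (complex.Re r))) ?ltrDl // le_max lexx orbT.
have := rb _ rs y; rewrite !rnormE -rmorphM lecR => /le_trans; apply.
by rewrite ler_piMr // addr_ge0 // le_max lexx.
Qed.

Lemma opnorm_ge0 V W (f : {linear V -> W}) : continuous f -> 0 <= opnorm f.
Proof.
move=> /has_sup_opnorm h; apply: (ub_le_sup h.2).
by exists 0; rewrite /= ?linear0 rnorm0.
Qed.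

Lemma le_opnorm V W (f : {linear V -> W}) (x : V) :
  continuous f -> rnorm (f x) <= opnorm f * rnorm x.
Proof.
move=> fc; have [->|x0] := eqVneq x 0; first by rewrite linear0 !rnorm0 mulr0.
have xp : 0 < rnorm x by rewrite lt_def rnorm_eq0 x0 rnorm_ge0.
rewrite -ler_pdivrMr //; apply: (ub_le_sup (has_sup_opnorm fc).2).
exists ((rnorm x)^-1%:C%C *: x) => /=.
  by rewrite rnormZ rnorm_real gtr0_norm ?invr_gt0 // mulVf // gt_eqF.
by rewrite linearZ /= rnormZ rnorm_real gtr0_norm ?invr_gt0 // mulrC.
Qed.

Lemma opnorm_le V W (f : V -> W) (c : R) :
  0 <= c -> (forall x, rnorm (f x) <= c * rnorm x) -> opnorm f <= c.
Proof.
move=> c0 fc; apply: ge_sup.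
  by exists (rnorm (f 0)), 0; rewrite //= rnorm0.
by move=> _ [x /= x1 <-]; rewrite (le_trans (fc x)) // ler_piMr.
Qed.
End RealNorm.

(** * Coefficients of degree zero and one of vector-valued polynomials *)

Section LowCoefficients.
Variable R : realType.
Implicit Types V W : lmodType R[i].

(** A polynomial in t of degree below [m], of which only the value and the derivative at 0 are
    recorded. The coefficients form a sequence that vanishes from [m] on, so that [m] can be raised
    freely and index 1 makes sense for every [m]. *)
Definition coef01 V (m : nat) (f : R[i] -> V) (c0 c1 : V) : Prop :=
  exists c : nat -> V, [/\ forall i, (m <= i)%N -> c i = 0, c 0%N = c0,
    c 1%N = c1 & forall t, f t = \sum_(i < m) t ^+ i *: c i].

Lemma eq_coef01 V m (f g : R[i] -> V) a b a' b' :
  coef01 m f a b -> f =1 g -> a = a' -> b = b' -> coef01 m g a' b'.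
Proof.
by move=> [c [? ? ? fc]] fg <- <-; exists c; split=> // t; rewrite -fg.
Qed.

Lemma coef01_le V m m' (f : R[i] -> V) a b :
  (m <= m')%N -> coef01 m f a b -> coef01 m' f a b.
Proof.
move=> mm' [c [cm c0 c1 fc]]; exists c; split=> //.
  by move=> i /(leq_trans mm'); exact: cm.
move=> t; rewrite fc -!(big_mkord xpredT (fun i => t ^+ i *: c i)).
rewrite (big_cat_nat (leq0n m) mm') //= [X in _ + X]big1_seq ?addr0 // => i /andP[_].
by rewrite mem_index_iota => /andP[mi _]; rewrite cm ?scaler0.
Qed.

Lemma coef01_cst V m (v : V) : (0 < m)%N -> coef01 m (fun=> v) v 0.
Proof.
case: m => // m _; exists (fun i => if i == 0%N then v else 0); split=> //.
  by case.
by move=> t; rewrite big_ord_recl big1 ?addr0 ?scale1r // => i _; rewrite scaler0.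
Qed.

Lemma coef01D V m (f g : R[i] -> V) a b a' b' :
  coef01 m f a b -> coef01 m g a' b' ->
  coef01 m (fun t => f t + g t) (a + a') (b + b').
Proof.
move=> [c [cm <- <- fc]] [d [dm <- <- gd]]; exists (fun i => c i + d i).
split=> // [i mi|t]; first by rewrite cm ?dm ?addr0.
by rewrite fc gd -big_split; apply: eq_bigr => i _; rewrite scalerDr.
Qed.

Lemma coef01_linear V W m (g : V -> W) (f : R[i] -> V) a b :
  linear g -> coef01 m f a b -> coef01 m (fun t => g (f t)) (g a) (g b).
Proof.
move=> gl.
pose h : {linear V -> W} := HB.pack g (GRing.isLinear.Build _ _ _ _ g gl).
rewrite -[g]/(h : V -> W) => -[c [cm <- <- fc]]; exists (fun i => h (c i)); split=> //.
  by move=> i mi; rewrite cm ?linear0.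
by move=> t; rewrite fc linear_sum; apply: eq_bigr => i _; rewrite linearZ.
Qed.

Lemma coef01Z V m s (f : R[i] -> V) a b :
  coef01 m f a b -> coef01 m (fun t => s *: f t) (s *: a) (s *: b).
Proof.
apply: coef01_linear => r u v; by rewrite scalerDr !scalerA mulrC.
Qed.

Lemma coef01X V m (f : R[i] -> V) a b :
  coef01 m f a b -> coef01 m.+1 (fun t => t *: f t) 0 a.
Proof.
move=> [c [cm <- _ fc]]; exists (fun i => if i is j.+1 then c j else 0).
split=> // [[|i]|t] //; first exact: cm.
rewrite big_ord_recl scaler0 add0r fc scaler_sumr.
by apply: eq_bigr => i _; rewrite scalerA -exprS.
Qed.

(** Orthogonality of characters: this is a geometric sum of ratio w^(i-1), an m-th root of unity
    that differs from 1 unless i = 1. *)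
Lemma sum_prim_root_expr (K : fieldType) m (w : K) i :
  m.-primitive_root w -> (1 < m)%N -> (i < m)%N ->
  \sum_(j < m) w^-1 ^+ j * (w ^+ j) ^+ i = (i == 1%N)%:R * m%:R.
Proof.
move=> wP m1 im.
have w0 : w != 0 by rewrite (prim_root_eq0 wP) gtn_eqF // ltnW.
have E (j : 'I_m) : w^-1 ^+ j * (w ^+ j) ^+ i = (w^-1 * w ^+ i) ^+ j.
  by rewrite exprMn -!exprM mulnC.
rewrite (eq_bigr _ (fun j _ => E j)); case: eqVneq => [->|i1].
  rewrite mul1r expr1 mulVf // (eq_bigr (fun=> 1)) => [|j _]; last first.
    by rewrite expr1n.
  by rewrite sumr_const card_ord.
rewrite mul0r; set x := _ * _.
have x1 : x - 1 != 0.
  rewrite subr_eq0; apply: contraNneq i1 => /(congr1 ( *%R w)).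
  rewrite mulrA mulfV // mul1r mulr1 => h.
  have /eqP := h; rewrite -{2}(expr1 w) (eq_prim_root_expr wP).
  by rewrite !modn_small.
apply: (mulfI x1); rewrite mulr0 -subrX1 exprMn -exprM mulnC exprM.
by rewrite exprVn (prim_expr_order wP) expr1n invr1 mulr1 subrr.
Qed.

(** A discrete Cauchy formula, exact in degree below [m]. The radius [s] stays free because it is
    optimized later. *)
Lemma coef01_mean V m w s (f : R[i] -> V) a b :
  (1 < m)%N -> m.-primitive_root w -> s != 0 -> coef01 m f a b ->
  b = (m%:R * s)^-1 *: \sum_(j < m) w^-1 ^+ j *: f (s * w ^+ j).
Proof.
move=> m1 wP s0 [c [_ _ <- fc]].
have ms0 : m%:R * s != 0 by rewrite mulf_neq0 // pnatr_eq0 gtn_eqF // ltnW.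
apply: (scalerI ms0); rewrite scalerA mulfV // scale1r.
under eq_bigr do rewrite fc scaler_sumr.
rewrite exchange_big /=.
have E (i : 'I_m) : \sum_(j < m) w^-1 ^+ j *: ((s * w ^+ j) ^+ i *: c i) =
    (s ^+ i * ((i == 1%N :> nat)%:R * m%:R)) *: c i.
  rewrite -(sum_prim_root_expr wP m1 (ltn_ord i)) mulr_sumr scaler_suml.
  by apply: eq_bigr => j _; rewrite scalerA exprMn mulrCA.
under eq_bigr do rewrite E.
rewrite (bigD1 (Ordinal m1)) //= mul1r expr1 mulrC big1 ?addr0 // => i i1.
by rewrite (_ : (i == 1%N :> nat) = false) ?mul0r ?mulr0 ?scale0r //; apply/negbTE.
Qed.

(** Once both degree bounds are raised to a common one, the two coefficients are the same mean of
    values of [f]. *)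
Lemma coef01_uniq V m m' (f : R[i] -> V) a b a' b' :
  coef01 m f a b -> coef01 m' f a' b' -> b = b'.
Proof.
pose n := (m + m' + 2)%N; have n1 : (1 < n)%N by rewrite /n addn2.
have [w wP] := closed_field_prim_root (R[i]) (ltnW n1).
move=> /(@coef01_le _ _ n) h /(@coef01_le _ _ n) h'.
rewrite (coef01_mean n1 wP (oner_neq0 _) (h _)) ?(coef01_mean n1 wP (oner_neq0 _) (h' _)) //.
  by rewrite /n -addnA addnCA leq_addr.
by rewrite /n -addnA leq_addr.
Qed.

End LowCoefficients.

(** * Multilinear maps, symmetrization and the derivative along a line *)

Section Multilinear.
Variable R : realType.

Section Maps.
Variables (k : nat) (E F : lmodType R[i]).
Implicit Types (M : ('I_k -> E) -> F).

Lemma dfwithE (x : 'I_k -> E) i v j :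
  dfwith x i v j = if j == i then v else x j.
Proof. by case: dfwithP => [|l]; rewrite ?eqxx // eq_sym => /negbTE->. Qed.

Lemma coef01_multilinear M (x a : E) m (z : 'I_k -> E) :
  multilinear M -> (m <= k)%N ->
  coef01 m.+1 (fun t => M (fun i => if (i < m)%N then x + t *: a else z i))
    (M (fun i => if (i < m)%N then x else z i))
    (\sum_(l < k | (l < m)%N)
       M (fun i => if i == l then a else if (i < m)%N then x else z i)).
Proof.
move=> Mm; elim: m z => [|m IH] z mk.
  rewrite big_pred0 //; exact: coef01_cst.
pose o := Ordinal mk.
have ltS (i : 'I_k) : (i < m.+1)%N = (i == o) || (i < m)%N.
  by rewrite ltnS leq_eqVlt.
have om : (o < m)%N = false by rewrite /= ltnn.
have IHx := IH (dfwith z o x) (ltnW mk).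
have IHa := IH (dfwith z o a) (ltnW mk).
apply: (eq_coef01 (coef01D (coef01X IHa) (coef01_le (leqnSn _) IHx))).
- move=> t; have := Mm o (fun i => if (i < m)%N then x + t *: a else z i) t a x.
  rewrite [in LHS](_ : dfwith _ o (t *: a + x) =
      (fun i : 'I_k => if (i < m.+1)%N then x + t *: a else z i)); last first.
    by apply/funext => i; rewrite dfwithE ltS; case: eqP; rewrite //= addrC.
  move->; congr (_ *: M _ + M _); apply/funext => i; rewrite !dfwithE;
    by case: eqP => [->|]; rewrite ?om.
- rewrite add0r; congr (M _); apply/funext => i; rewrite dfwithE ltS.
  by case: eqP => [->|]; rewrite ?om.
- rewrite [RHS](bigD1 o) /= ?ltnSn //; congr (_ + _).
    congr (M _); apply/funext => i; rewrite dfwithE ltS.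
    by case: eqP => [->|]; rewrite ?om.
  apply: eq_big => [l|l lm].
    by rewrite ltS; case: eqP => [->|]; rewrite ?om ?andbF //= andbT.
  congr (M _); apply/funext => i; rewrite dfwithE ltS.
  case: (i == l) => //; by case: eqP => [->|]; rewrite ?om.
Qed.

(** Averaging over permutations keeps the diagonal values, so a homogeneous polynomial can be
    exhibited by a multilinear map without checking symmetry. *)
Lemma multilinear_symmetrize M : multilinear M ->
  exists M', polar_of (fun x => M (fun=> x)) M'.
Proof.
move=> Mm; exists (fun x => (k`!%:R)^-1 *: \sum_(s : 'S_k) M (x \o s)); split.
- move=> i x a u v.
  rewrite !scalerA (mulrC a) -scalerA -scalerDr; congr (_ *: _).
  rewrite scaler_sumr -big_split /=; apply: eq_bigr => s _.
  (* Permuting the arguments by [s] moves the altered slot from i to s^-1 i. *)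
  have H w : dfwith x i w \o s = dfwith (x \o s) (s^-1%g i) w.
    by apply/funext => j /=; rewrite !dfwithE /= (canF_eq (permK s)).
  by rewrite !H Mm.
- move=> s x; congr (_ *: _); rewrite [RHS](reindex_inj (mulIg s)) /=.
  apply: eq_bigr => u _; congr (M _); apply/funext => j /=.
  by rewrite permM.
- move=> x; rewrite (eq_bigr (fun=> M (fun=> x))) // sumr_const.
  by rewrite card_Sn -[M _ *+ _]scaler_nat scalerA mulVf ?scale1r ?pnatr_eq0 -?lt0n ?fact_gt0.
Qed.

End Maps.

Lemma coef01_polar_of k (E F : lmodType R[i]) (P : E -> F) M (x a : E) :
  @polar_of R k.+1 E F P M ->
  coef01 k.+2 (fun t => P (x + t *: a)) (P x)
    (k.+1%:R *: M (fun i => if i == ord0 then a else x)).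
Proof.
move=> [Mm Ms PM].
apply: (eq_coef01 (coef01_multilinear x a (fun=> x) Mm (leqnn k.+1))).
- by move=> t; rewrite PM; congr (M _); apply/funext => i; rewrite ltn_ord.
- by rewrite PM; congr (M _); apply/funext => i; rewrite ltn_ord.
rewrite (eq_bigl xpredT) => [|l]; last by rewrite ltn_ord.
rewrite (eq_bigr (fun=> M (fun i => if i == ord0 then a else x))).
  by rewrite sumr_const card_ord scaler_nat.
(* The transposition carries [a] from slot 0 to slot [l], so the k+1 terms of the derivative
   coincide. *)
move=> l _; rewrite -[RHS](Ms (tperm ord0 l)); congr (M _); apply/funext => i /=.
by rewrite if_same (canF_eq (tpermK ord0 l)) tpermL.
Qed.

End Multilinear.

(** * Continuous homogeneous polynomials and their derivatives P_a *)

Section ContinuousPolynomials.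
Variable R : realType.
Local Notation banach := (completeNormedModType R[i]).
Implicit Types E F : banach.

Lemma cpoly_multilinear k E F (P : E -> F) (M : ('I_k -> E) -> F) :
  continuous P -> multilinear M -> (forall x, P x = M (fun=> x)) -> cpoly k P.
Proof.
move=> Pc /multilinear_symmetrize[M' M'P] PM; split=> //; exists M'.
by have -> : P = (fun x => M (fun=> x)) by apply/funext.
Qed.

Lemma polarP k E F (P : E -> F) : cpoly k P -> polar_of P (polar (k := k) P).
Proof. by move=> [_ [M MP]]; exact: xgetPex (ex_intro _ M MP). Qed.

Lemma cpoly0 k E F : cpoly k (0 : E -> F).
Proof.
apply: (@cpoly_multilinear _ _ _ _ (fun=> 0)) => //; first by move=> x; exact: cvg_cst.
by move=> i x a u v; rewrite scaler0 addr0.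
Qed.

Lemma cpoly_linear k E F (a : R[i]) (P Q : E -> F) :
  cpoly k P -> cpoly k Q -> cpoly k (a *: P + Q).
Proof.
move=> Pc Qc; have [[Pm _ PM] [Qm _ QM]] := (polarP Pc, polarP Qc).
apply: (@cpoly_multilinear _ _ _ _
    (fun x => a *: polar (k := k) P x + polar (k := k) Q x)).
- by move=> x; apply: cvgD; [apply: cvgZr; exact: Pc.1|exact: Qc.1].
- move=> i x b u v; rewrite Pm Qm !scalerDr !scalerA (mulrC a b).
  by rewrite addrACA.
- by move=> x; rewrite -PM -QM.
Qed.

Lemma cpoly_comp k E1 E F F1 (T : {linear E1 -> E}) (P : E -> F)
    (S : {linear F -> F1}) :
  continuous T -> continuous S -> cpoly k P -> cpoly k (S \o P \o T).
Proof.
move=> Tc Sc Pc; have [Pm _ PM] := polarP Pc.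
apply: (@cpoly_multilinear _ _ _ _ (fun x => S (polar (k := k) P (T \o x)))).
- move=> x; apply: (@continuous_comp _ _ _ T (S \o P)); first exact: Tc.
  by apply: continuous_comp; [exact: Pc.1|exact: Sc].
- move=> i x b u v.
  have H w : T \o dfwith x i w = dfwith (T \o x) i (T w).
    by apply/funext => j /=; rewrite !dfwithE; case: eqP.
  by rewrite !H linearP Pm linearP.
- by move=> x; rewrite /= PM.
Qed.

Lemma cpoly_mulfunctional k E F (g : {linear E -> R[i]}) (P : E -> F) :
  continuous g -> cpoly k P -> cpoly k.+1 (mulfunctional g P).
Proof.
move=> gc Pc; have [Pm _ PM] := polarP Pc.
apply: (@cpoly_multilinear _ _ _ _
    (fun x => g (x ord0) *: polar (k := k) P (x \o lift ord0))).
- by move=> x; apply: cvgZ; [exact: gc|exact: Pc.1].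
- move=> i x b u v; case: (unliftP ord0 i) => [j ->|->].
    have H w : dfwith x (lift ord0 j) w \o lift ord0 =
        dfwith (x \o lift ord0) j w.
      by apply/funext => l /=; rewrite !dfwithE (inj_eq lift_inj).
    by rewrite !H !dfwithE /= Pm scalerDr !scalerA mulrC.
  have H w : dfwith x ord0 w \o lift ord0 = x \o lift ord0.
    by apply/funext => l /=; rewrite !dfwithE.
  by rewrite !H !dfwithE eqxx linearP scalerDl scalerA.
- by move=> x; rewrite /= -PM.
Qed.

Lemma coef01_polder k E F (P : E -> F) (x a : E) : cpoly k.+1 P ->
  coef01 k.+2 (fun t => P (x + t *: a)) (P x) (k.+1%:R *: polder k P a x).
Proof. by move=> /polarP; exact: coef01_polar_of. Qed.

(** Access to P_a without its polar form: expand P(x + t a) in any way, then divide the linear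
    coefficient by the degree. The composition and product rules are obtained so. *)
Lemma polder_coef01 k m E F (P : E -> F) (x a : E) c0 c1 : cpoly k.+1 P ->
  coef01 m (fun t => P (x + t *: a)) c0 c1 ->
  polder k P a x = k.+1%:R^-1 *: c1.
Proof.
move=> /(coef01_polder x a)/coef01_uniq h /h <-.
by rewrite scalerA mulVf ?scale1r // pnatr_eq0.
Qed.

(** P(x + t a) has degree at most k+1 in t, so k+2 nodes suffice. *)
Lemma polder_mean k E F (P : E -> F) (x a : E) (w s : R[i]) :
  cpoly k.+1 P -> k.+2.-primitive_root w -> s != 0 ->
  polder k P a x = (k.+1%:R * (k.+2%:R * s))^-1 *:
    \sum_(j < k.+2) w^-1 ^+ j *: P (x + (s * w ^+ j) *: a).
Proof.
move=> Pc wP s0; have := coef01_polder x a Pc.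
move=> /(coef01_mean (isT : (1 < k.+2)%N) wP s0) h.
by rewrite invfM -scalerA -h scalerA mulVf ?scale1r // pnatr_eq0.
Qed.

Lemma polder_diag k E F (P : E -> F) x : cpoly k.+1 P -> polder k P x x = P x.
Proof.
move=> /polarP[_ _ ->]; congr (polar _ _); apply/funext => i.
by rewrite if_same.
Qed.

Lemma polderZ k E F (P : E -> F) s a x :
  cpoly k.+1 P -> polder k P (s *: a) x = s *: polder k P a x.
Proof.
move=> /polarP[Pm _ _]; have H v : dfwith (fun=> x) ord0 v = fun i : 'I_k.+1 => if i == ord0 then v else x.
  by apply/funext => i; rewrite dfwithE.
have M0 : polar P (dfwith (fun=> x) (ord0 : 'I_k.+1) 0) = 0.
  by have := Pm ord0 (fun=> x) (-1) 0 0; rewrite scaler0 addr0 scaleN1r addNr.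
by rewrite /polder -!H -[s *: a]addr0 Pm M0 addr0.
Qed.

Lemma cpoly_at0 k E F (P : E -> F) : cpoly k.+1 P -> P 0 = 0.
Proof.
by move=> Pc; rewrite -(polder_diag 0 Pc) -[X in polder _ _ X _](scale0r (0 : E)) polderZ // scale0r.
Qed.

Lemma polder_linear k E F (c : R[i]) (P Q : E -> F) a :
  cpoly k.+1 P -> cpoly k.+1 Q ->
  polder k (c *: P + Q) a = c *: polder k P a + polder k Q a.
Proof.
move=> Pc Qc; apply/funext => x.
have := coef01D (coef01Z c (coef01_polder x a Pc)) (coef01_polder x a Qc).
move=> /(polder_coef01 (cpoly_linear c Pc Qc)) ->.
by rewrite scalerDr !scalerA (mulrC _ c) -mulrA mulVf ?mulr1 ?scale1r ?pnatr_eq0.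
Qed.

Lemma polder_comp k E1 E F F1 (T : {linear E1 -> E}) (P : E -> F)
    (S : {linear F -> F1}) a :
  continuous T -> continuous S -> cpoly k.+1 P ->
  polder k (S \o P \o T) a = S \o polder k P (T a) \o T.
Proof.
move=> Tc Sc Pc; apply/funext => x.
have h := coef01_linear (linearP S) (coef01_polder (T x) (T a) Pc).
rewrite (polder_coef01 (cpoly_comp Tc Sc Pc) (eq_coef01 h _ erefl erefl)).
  by rewrite linearZ scalerA mulVf ?scale1r ?pnatr_eq0.
by move=> t; rewrite /= linearD linearZ.
Qed.

Lemma polder_mulfunctional k E F (g : {linear E -> R[i]}) (P : E -> F) a x :
  continuous g -> cpoly k.+1 P ->
  polder k.+1 (mulfunctional g P) a x =
  k.+2%:R^-1 *: (g a *: P x + k.+1%:R *: (g x *: polder k P a x)).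
Proof.
move=> gc Pc; have h := coef01_polder x a Pc.
have h2 := coef01D (coef01X (coef01Z (g a) h)) (coef01_le (leqnSn _) (coef01Z (g x) h)).
rewrite (polder_coef01 (cpoly_mulfunctional gc Pc) (eq_coef01 h2 _ erefl erefl)).
  by rewrite !scalerA (mulrC (g x)).
move=> t; have gt : g (t *: a) = t * g a by rewrite linearZ.
by rewrite /mulfunctional linearD gt /= scalerDl scalerA addrC.
Qed.

(** By the mean formula P_a is a finite combination of translates of P, which spares proving the
    polar form continuous. *)
Lemma continuous_polder k E F (P : E -> F) a :
  cpoly k.+1 P -> continuous (polder k P a).
Proof.
move=> Pc; have [w wP] := closed_field_prim_root (R[i]) (ltn0Sn k.+1).
rewrite (_ : polder k P a = fun x => (k.+1%:R * (k.+2%:R * 1))^-1 *: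
    \sum_(j < k.+2) w^-1 ^+ j *: P (x + (1 * w ^+ j) *: a)); last first.
  by apply/funext => x; exact: polder_mean.
move=> x; apply: cvgZr.
apply: (@continuous_big _ _ +%R) => [|j _ {}x]; first exact: add_continuous.
apply: cvgZr.
apply: (@continuous_comp _ _ _ (fun y => y + (1 * w ^+ j) *: a) P).
  by apply: cvgD; [exact: cvg_id|exact: cvg_cst].
exact: Pc.1.
Qed.

Lemma cpoly_polder k E F (P : E -> F) a : cpoly k.+1 P -> cpoly k (polder k P a).
Proof.
move=> Pc; have [Pm _ _] := polarP Pc.
apply: (@cpoly_multilinear _ _ _ _
    (fun x => polar P (fun i : 'I_k.+1 => oapp x a (unlift ord0 i)))).
- exact: continuous_polder.
- move=> i x b u v.
  have H w : (fun j => oapp (dfwith x i w) a (unlift ord0 j)) =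
      dfwith (fun j : 'I_k.+1 => oapp x a (unlift ord0 j)) (lift ord0 i) w.
    apply/funext => j; rewrite dfwithE; case: unliftP => [l ->|->] //=.
    by rewrite dfwithE (inj_eq lift_inj).
  by rewrite !H Pm.
- move=> x; congr (polar _ _); apply/funext => j.
  by case: unliftP => [l ->|->] /=; rewrite ?eqxx // eq_sym (negbTE (neq_lift _ _)).
Qed.

End ContinuousPolynomials.

(** * Working form of the ideal axioms *)

Section NormedIdeals.
Variable R : realType.
Local Notation banach := (completeNormedModType R[i]).
Variables (k : nat) (A : polyclass R).
Hypothesis Aid : normed_ideal k A.
Implicit Types E F : banach.

Lemma ideal_cpoly E F (P : E -> F) : A E F P -> cpoly k P.
Proof. by have [/(_ E F)[h _ _ _] _ _] := Aid; apply: h. Qed.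

Lemma ideal0 E F : A E F 0.
Proof. by have [/(_ E F)[_ h _ _] _ _] := Aid. Qed.

Lemma ideal_lin E F a (P Q : E -> F) : A E F P -> A E F Q -> A E F (a *: P + Q).
Proof. by have [/(_ E F)[_ _ h _] _ _] := Aid; apply: h. Qed.

Lemma inorm_ge0 E F (P : E -> F) : A E F P -> 0 <= inorm A P.
Proof. by have [/(_ E F)[_ _ _ [h _ _ _]] _ _] := Aid; apply: h. Qed.

Lemma inorm_eq0 E F (P : E -> F) : A E F P -> inorm A P = 0 -> P = 0.
Proof. by have [/(_ E F)[_ _ _ [_ h _ _]] _ _] := Aid; apply: h. Qed.

Lemma inormZ E F a (P : E -> F) :
  A E F P -> inorm A (a *: P) = rnorm a * inorm A P.
Proof. by have [/(_ E F)[_ _ _ [_ _ h _]] _ _] := Aid; apply: h. Qed.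

Lemma ler_inormD E F (P Q : E -> F) :
  A E F P -> A E F Q -> inorm A (P + Q) <= inorm A P + inorm A Q.
Proof. by have [/(_ E F)[_ _ _ [_ _ _ h]] _ _] := Aid; apply: h. Qed.

Lemma idealZ E F a (P : E -> F) : A E F P -> A E F (a *: P).
Proof. by move=> AP; rewrite -[_ *: _]addr0; apply: ideal_lin => //; exact: ideal0. Qed.

Lemma idealD E F (P Q : E -> F) : A E F P -> A E F Q -> A E F (P + Q).
Proof. by move=> AP AQ; rewrite -[P]scale1r; exact: ideal_lin. Qed.

Lemma inorm0 E F : inorm A (0 : E -> F) = 0.
Proof. by rewrite -(scale0r (0 : E -> F)) inormZ ?rnorm0 ?mul0r //; exact: ideal0. Qed.

Lemma ideal_sum E F m (P : 'I_m -> E -> F) c :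
  (forall j, A E F (P j) /\ inorm A (P j) <= c) ->
  A E F (\sum_j P j) /\ inorm A (\sum_j P j) <= m%:R * c.
Proof.
elim: m P => [|m IH] P AP.
  by rewrite big_ord0 mul0r inorm0; split=> //; exact: ideal0.
have [] := IH _ (fun j => AP (lift ord0 j)); rewrite big_ord_recl => h1 h2.
have [h3 h4] := AP ord0; split; first exact: idealD.
apply: le_trans (ler_inormD h3 h1) _.
by rewrite mulrSr addrC mulrDl mul1r lerD.
Qed.

(** Applications give linear maps as explicit functions with an evident bound, so any bounds [t] and
    [s] replace the operator norms. *)
Lemma ideal_comp E1 E F F1 (T : E1 -> E) (S : F -> F1) (P : E -> F) (t s : R) :
  linear T -> linear S -> 0 <= t -> 0 <= s ->
  (forall x, rnorm (T x) <= t * rnorm x) ->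
  (forall y, rnorm (S y) <= s * rnorm y) -> A E F P ->
  A E1 F1 (S \o P \o T) /\ inorm A (S \o P \o T) <= s * inorm A P * t ^+ k.
Proof.
move=> Tl Sl t0 s0 Tt Ss AP.
pose T' : {linear E1 -> E} := HB.pack T (GRing.isLinear.Build _ _ _ _ T Tl).
pose S' : {linear F -> F1} := HB.pack S (GRing.isLinear.Build _ _ _ _ S Sl).
have Tc := bounded_continuous Tl Tt; have Sc := bounded_continuous Sl Ss.
have [_ /(_ _ _ _ _ T' P S' Tc Sc AP)[h1 h2] _] := Aid; split => //.
apply: (le_trans h2); have P0 := inorm_ge0 AP.
have oT0 := opnorm_ge0 (f := T') Tc; have oS0 := opnorm_ge0 (f := S') Sc.
apply: ler_pM; rewrite ?mulr_ge0 ?exprn_ge0 //.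
  by rewrite ler_wpM2r // opnorm_le.
by rewrite lerXn2r ?nnegrE // opnorm_le.
Qed.

Lemma ideal_precomp E1 E F (T : E1 -> E) (P : E -> F) (t : R) :
  linear T -> 0 <= t -> (forall x, rnorm (T x) <= t * rnorm x) -> A E F P ->
  A E1 F (P \o T) /\ inorm A (P \o T) <= inorm A P * t ^+ k.
Proof.
move=> Tl t0 Tt /(ideal_comp (S := id) Tl _ t0 ler01 Tt) []//.
  by move=> y; rewrite mul1r.
by rewrite mul1r.
Qed.

End NormedIdeals.

(** The k-th power of 1 + x <= exp x at x = 1/k. The case k = 0 reads 1 <= e and is used as such. *)
Lemma expr1DV_le_expR (R : realType) k : (1 + k%:R^-1) ^+ k <= expR 1 :> R.
Proof.
case: k => [|k]; first by rewrite expr0 -[leLHS]expR0 ler_expR.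
rewrite -[X in expR X](@mulfV _ k.+1%:R) ?pnatr_eq0 // expRM_natl.
by rewrite lerXn2r ?nnegrE ?addr_ge0 ?expR_ge0 ?invr_ge0 // expR_ge1Dx.
Qed.

(** * The basic bound on mixed values of the polar form *)

Section MixedPolar.
Variables (R : realType) (k : nat) (A : polyclass R).
Local Notation banach := (completeNormedModType R[i]).
Hypothesis Aid : normed_ideal k.+1 A.

(* Averaging Q (T x + s w^j U x) over the (k+2)-th roots of unity w^j isolates
   the coefficient of degree one in s; s = 1 / (k u) minimizes the bound. *)
Lemma ideal_polder_comp (E1 E F : banach) (T U : E1 -> E) (Q : E -> F) (u : R) :
  linear T -> linear U -> 0 <= u ->
  (forall x, rnorm (T x) <= rnorm x) ->
  (forall x, rnorm (U x) <= u * rnorm x) -> A E F Q ->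
  A E1 F (fun x => polder k Q (U x) (T x)) /\
  inorm A (fun x => polder k Q (U x) (T x)) <= expR 1 * (u * inorm A Q).
Proof.
move=> Tl Ul u0 T1 Uu AQ.
have Qc := ideal_cpoly Aid AQ; have Q0 := inorm_ge0 Aid AQ.
(* The radius 1/(k u) requires k > 0 and u > 0. For k = 0 the polynomial is linear and the map is
   just [Q \o U]; for u = 0, treated next, [U] vanishes. *)
have [k0|k0] := posnP k.
  move: AQ Qc; move: Aid; rewrite {}k0 => Aid0 AQ Qc.
  have -> : (fun x => polder 0 Q (U x) (T x)) = Q \o U.
    apply/funext => x; rewrite /= -(polder_diag (U x) Qc); congr (polar _ _).
    by apply/funext => i; rewrite ord1 eqxx.
  have [h1 h2] := ideal_precomp Aid0 Ul u0 Uu AQ; split=> //.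
  apply: (le_trans h2); rewrite expr1 mulrC ler_peMl ?mulr_ge0 //.
  by have := expr1DV_le_expR R 0; rewrite expr0.
have [u00|u00] := eqVneq u 0.
  have -> : (fun x => polder k Q (U x) (T x)) = 0.
    apply/funext => x; have /eqP : rnorm (U x) = 0.
      by apply/eqP; rewrite eq_le rnorm_ge0 andbT (le_trans (Uu x)) // u00 mul0r.
    by rewrite rnorm_eq0 => /eqP ->; rewrite -(scale0r (0 : E)) polderZ // scale0r.
  rewrite (inorm0 Aid) u00 mul0r mulr0; split=> //; exact: ideal0 Aid _ _.
have up : 0 < u by rewrite lt_def u00.
have kp : 0 < k%:R :> R by rewrite ltr0n.
have [w wP] := closed_field_prim_root (R[i]) (ltn0Sn k.+1).
pose s : R := (k%:R * u)^-1.
have s0 : 0 < s by rewrite invr_gt0 mulr_gt0.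
have sC0 : s%:C%C != 0 by rewrite (inj_eq (@complexI _)) gt_eqF.
pose c : R[i] := (k.+1%:R * (k.+2%:R * s%:C%C))^-1.
pose V j x := T x + (s%:C%C * w ^+ j) *: U x.
have -> : (fun x => polder k Q (U x) (T x)) =
    c *: \sum_(j < k.+2) w^-1 ^+ j *: (Q \o V j).
  apply/funext => x; rewrite (polder_mean (T x) (U x) Qc wP sC0).
  by rewrite fctE fct_sumE.
have wn : rnorm w = 1 := rnorm_prim_root wP.
have Vl j : linear (V j).
  by move=> a x y; rewrite /V Tl Ul !scalerDr !scalerA (mulrC a) addrACA.
pose r : R := 1 + k%:R^-1.
have r0 : 0 <= r by rewrite addr_ge0 // invr_ge0 ltW.
have Vr j x : rnorm (V j x) <= r * rnorm x.
  apply: (le_trans (ler_rnormD _ _)); rewrite mulrDl mul1r lerD // rnormZ rnormM.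
  rewrite rnormX wn expr1n mulr1 rnorm_real gtr0_norm //.
  apply: (le_trans (ler_wpM2l (ltW s0) (Uu x))).
  by rewrite mulrA /s invfM mulfVK.
have [] := ideal_sum Aid (P := fun j : 'I_k.+2 => w^-1 ^+ j *: (Q \o V j))
    (c := inorm A Q * r ^+ k.+1).
  move=> j; have [h1 h2] := ideal_precomp Aid (Vl j) r0 (Vr j) AQ.
  rewrite (inormZ Aid) // rnormX rnormV wn invr1 expr1n mul1r.
  by split=> //; exact: idealZ Aid _ _ _ _ h1.
set S := \sum_j _ => AS Sle; rewrite (inormZ Aid) //; split; first exact: (idealZ Aid).
have -> : rnorm c = (k.+1%:R * (k.+2%:R * s))^-1.
  by rewrite rnormV !rnormM !rnorm_nat rnorm_real gtr0_norm.
apply: le_trans (ler_wpM2l _ Sle) _.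
  by rewrite invr_ge0 !mulr_ge0 // ltW.
(* Since (k+1) s = r / u, one of the k+1 factors [r] cancels. *)
have -> : (k.+1%:R * (k.+2%:R * s))^-1 * (k.+2%:R * (inorm A Q * r ^+ k.+1)) =
    r ^+ k * (u * inorm A Q).
  have rE : r = k.+1%:R / k%:R.
    by rewrite /r -addn1 natrD mulrDl mulfV ?gt_eqF // mul1r.
  rewrite exprSr {2}rE /s; move: (r ^+ k) => q; field.
  by apply/and4P; split; rewrite ?gt_eqF // ltr_wpDr.
by rewrite ler_wpM2r ?mulr_ge0 // expr1DV_le_expR.
Qed.

End MixedPolar.

(** * Raising the degree *)

Section UpClass.
Variable R : realType.
Local Notation banach := (completeNormedModType R[i]).
Implicit Types E F : banach.

(** Finiteness of the supremum is part of membership, because [sup] takes the default value 0 on an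
    unbounded set. *)
Definition up_class (k : nat) (A : polyclass R) : polyclass R :=
  PolyClass
    (fun E F => [set P | [/\ cpoly k.+1 P, forall a, A E F (polder k P a) &
       exists c, forall a, inorm A (polder k P a) <= c * rnorm a]])
    (fun E F P => sup [set inorm A (polder k P a) | a in [set a | rnorm a <= 1]]).

Lemma expr1_ge1 : 1 <= expR 1 :> R.
Proof. by have := expr1DV_le_expR R 0; rewrite expr0. Qed.

Lemma polderZfun k E F (P : E -> F) s a :
  cpoly k.+1 P -> polder k P (s *: a) = s *: polder k P a.
Proof. by move=> Pc; apply/funext => x; exact: polderZ. Qed.

Lemma coef01_expr k (x a : R[i]) :
  coef01 k.+2 (fun t => (x + t *: a) ^+ k.+1 : R[i]) (x ^+ k.+1)
    (k.+1%:R *: (a * x ^+ k)).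
Proof.
elim: k => [|k IH].
  have h := coef01D (coef01_cst x (isT : 0 < 2)%N) (coef01X (coef01_cst a (isT : 0 < 1)%N)).
  by apply: (eq_coef01 h); rewrite ?addr0 ?add0r ?mulr1 ?scale1r.
have h := coef01D (coef01_le (leqnSn _) (coef01Z x IH)) (coef01X (coef01Z a IH)).
apply: (eq_coef01 h).
- by move=> t; rewrite [RHS]exprS mulrDl -scalerAl.
- by rewrite addr0 [RHS]exprS.
- by rewrite -[in RHS]natr1 exprS /GRing.scale /=; ring.
Qed.

Lemma cpoly_exprS k :
  cpoly k (fun z : R[i] => z ^+ k) -> cpoly k.+1 (fun z : R[i] => z ^+ k.+1).
Proof.
move=> zc; rewrite (_ : (fun _ => _) = mulfunctional idfun (fun z => z ^+ k)).
  by apply: cpoly_mulfunctional => // x; exact: cvg_id.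
by apply/funext => z; exact: exprS.
Qed.

Lemma polder_expr k (a : R[i]) : cpoly k.+1 (fun z : R[i] => z ^+ k.+1) ->
  polder k (fun z : R[i] => z ^+ k.+1) a = a *: (fun z : R[i] => z ^+ k).
Proof.
move=> zc; apply/funext => x.
by rewrite (polder_coef01 zc (coef01_expr k x a)) scalerA mulVf ?scale1r ?pnatr_eq0.
Qed.

Section Ideal.
Variables (k : nat) (A : polyclass R).
Hypothesis Aid : normed_ideal k A.

Lemma le_inorm_up E F (P : E -> F) a :
  up_class k A E F P -> inorm A (polder k P a) <= inorm (up_class k A) P * rnorm a.
Proof.
move=> [Pc AP [c cP]].
have [->|a0] := eqVneq a 0.
  by rewrite -(scale0r 0) polderZfun // scale0r (inorm0 Aid) scale0r rnorm0 mulr0.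
have ap : 0 < rnorm a by rewrite lt_def rnorm_eq0 a0 rnorm_ge0.
rewrite -ler_pdivrMr //; apply: ub_le_sup.
  exists (Num.max 0 c) => _ [b /= b1 <-]; apply: (le_trans (cP b)).
  apply: (@le_trans _ _ (Num.max 0 c * rnorm b)).
    by rewrite ler_wpM2r ?rnorm_ge0 // le_max lexx orbT.
  by rewrite ler_piMr // le_max lexx.
exists ((rnorm a)^-1%:C%C *: a) => /=.
  by rewrite rnormZ rnorm_real gtr0_norm ?invr_gt0 // mulVf // gt_eqF.
rewrite polderZfun // (inormZ Aid) // rnorm_real gtr0_norm ?invr_gt0 //.
by rewrite mulrC.
Qed.

Lemma inorm_up_le E F (P : E -> F) c : 0 <= c ->
  (forall a, inorm A (polder k P a) <= c * rnorm a) -> inorm (up_class k A) P <= c.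
Proof.
move=> c0 cP; apply: ge_sup.
  by exists (inorm A (polder k P 0)), 0; rewrite //= rnorm0.
by move=> _ [a /= a1 <-]; rewrite (le_trans (cP a)) // ler_piMr.
Qed.

Lemma inorm_up_ge0 E F (P : E -> F) :
  up_class k A E F P -> 0 <= inorm (up_class k A) P.
Proof.
move=> AP; have [Pc AP1 [c cP]] := AP.
apply: (@le_trans _ _ (inorm A (polder k P 0))); first exact: inorm_ge0 Aid _ _ _ _.
apply: ub_le_sup; last by exists 0; rewrite //= rnorm0.
exists (Num.max 0 c) => _ [b /= b1 <-]; apply: (le_trans (cP b)).
apply: (@le_trans _ _ (Num.max 0 c * rnorm b)).
  by rewrite ler_wpM2r ?rnorm_ge0 // le_max lexx orbT.
by rewrite ler_piMr // le_max lexx.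
Qed.

Lemma up_classI E F (P : E -> F) c : 0 <= c -> cpoly k.+1 P ->
  (forall a, A E F (polder k P a) /\ inorm A (polder k P a) <= c * rnorm a) ->
  up_class k A E F P /\ inorm (up_class k A) P <= c.
Proof.
move=> c0 Pc h; split; last by apply: inorm_up_le => // a; have [] := h a.
by split=> // [a|]; [have [] := h a|exists c => a; have [] := h a].
Qed.

Lemma normed_ideal_up : normed_ideal k.+1 (up_class k A).
Proof.
(* This one estimate yields stability under combinations, the triangle inequality and half of
   homogeneity. *)
have lin E F (c : R[i]) (P Q : E -> F) :
    up_class k A E F P -> up_class k A E F Q ->
    up_class k A E F (c *: P + Q) /\ inorm (up_class k A) (c *: P + Q) <=
      rnorm c * inorm (up_class k A) P + inorm (up_class k A) Q.
  move=> UP UQ; have [[Pc AP _] [Qc AQ _]] := (UP, UQ).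
  apply: up_classI.
  - by rewrite addr_ge0 ?mulr_ge0 ?rnorm_ge0 ?inorm_up_ge0.
  - exact: cpoly_linear.
  - move=> a; rewrite polder_linear //; split; first exact: (ideal_lin Aid).
    apply: (le_trans (ler_inormD Aid (idealZ Aid c (AP a)) (AQ a))).
    by rewrite (inormZ Aid) // mulrDl -mulrA lerD ?ler_wpM2l ?rnorm_ge0 ?le_inorm_up.
have up0 E F : up_class k A E F 0 /\ inorm (up_class k A) (0 : E -> F) <= 0.
  apply: up_classI; [by []|exact: cpoly0|move=> a].
  have -> : polder k (0 : E -> F) a = 0.
    have := polder_linear (-1) a (cpoly0 k.+1 E F) (cpoly0 k.+1 E F).
    by rewrite scaler0 addr0 scaleN1r addNr.
  by rewrite mul0r (inorm0 Aid); split=> //; exact: (ideal0 Aid).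
split.
- move=> E F; split.
  + by move=> P [].
  + exact: (up0 E F).1.
  + by move=> a P Q UP UQ; exact: (lin _ _ a _ _ UP UQ).1.
  split.
  + by move=> P; exact: inorm_up_ge0.
  (* Definiteness comes from P(x) = P_x(x): norm zero makes every P_x vanish. *)
  + move=> P UP P0; have [Pc AP _] := UP; apply/funext => x.
    rewrite -(polder_diag x Pc).
    suff -> : polder k P x = 0 by [].
    apply: (inorm_eq0 Aid) => //; apply/eqP; rewrite eq_le (inorm_ge0 Aid) // andbT.
    by rewrite (le_trans (le_inorm_up x UP)) // P0 mul0r.
  (* The reverse inequality is this one applied to a^-1 and a P. *)
  + have le1 a P : up_class k A E F P ->
        inorm (up_class k A) (a *: P) <= rnorm a * inorm (up_class k A) P.
      move=> UP; have [U0 n0] := up0 E F; have [_] := lin _ _ a _ _ UP U0.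
      by rewrite addr0 => /le_trans; apply; rewrite gerDl.
    move=> a P UP; apply/eqP; rewrite eq_le le1 //=.
    have [->|a0] := eqVneq a 0.
      by rewrite rnorm0 mul0r scale0r inorm_up_ge0 //; exact: (up0 E F).1.
    have ap : 0 < rnorm a by rewrite lt_def rnorm_eq0 a0 rnorm_ge0.
    have UaP : up_class k A E F (a *: P).
      by have := (lin _ _ a _ _ UP (up0 E F).1).1; rewrite addr0.
    have := le1 a^-1 _ UaP; rewrite scalerA mulVf // scale1r rnormV mulrC.
    by rewrite ler_pdivlMr // mulrC.
  + move=> P Q UP UQ; have [_] := lin _ _ 1 _ _ UP UQ.
    by rewrite scale1r rnorm1 mul1r.
- move=> E1 E F F1 T P S Tc Sc UP; have [Pc AP _] := UP.
  have oT := opnorm_ge0 Tc; have oS := opnorm_ge0 Sc; have nP := inorm_up_ge0 UP.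
  apply: up_classI; rewrite ?mulr_ge0 ?exprn_ge0 //; first exact: cpoly_comp.
  (* The direction becomes T a, and |T a| <= |T| |a| supplies the last of the k+1 factors |T|. *)
  move=> a; rewrite polder_comp //; have [_ /(_ _ _ _ _ T _ S Tc Sc (AP (T a)))] := Aid.
  move=> [h1 h2] _; split=> //; apply: (le_trans h2).
  rewrite exprS -!mulrA; apply: ler_wpM2l => //.
  apply: (@le_trans _ _ (inorm (up_class k A) P * rnorm (T a) * opnorm T ^+ k)).
    by rewrite ler_wpM2r ?exprn_ge0 // le_inorm_up.
  rewrite -mulrA; apply: ler_wpM2l => //.
  rewrite mulrCA mulrC ; apply: ler_wpM2l; rewrite ?exprn_ge0 //.
  by rewrite le_opnorm.
(* The derivative of z^(k+1) in direction a is a z^k, of norm |a|, and the direction 1 attains the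
   supremum. *)
- have [_ _ [Az nz]] := Aid.
  have h1 := cpoly_exprS (ideal_cpoly Aid Az); have h2 := polder_expr 1 h1.
  have [||U1 n1] := @up_classI _ _ (fun z : R[i] => z ^+ k.+1) 1 _ h1.
  + by [].
  + by move=> a; rewrite (polder_expr a h1) (inormZ Aid) // nz mulr1 mul1r; split=> //; exact: (idealZ Aid).
  split=> //; apply/eqP; rewrite eq_le n1 /=.
  have := le_inorm_up (1 : R[i]) U1; rewrite h2 rnorm1 mulr1 (inormZ Aid) // rnorm1 nz mulr1.
  by [].
Qed.

End Ideal.

(** By the product rule (g P)_a is the average of g(a) P and g(x) P_a(x) with weights 1 and k+1. The
    second term is a mixed polar value of P with U x = g(x) a, so both are at most e |g| |a| |P|. *)
Lemma up_mulfunctional k (A : polyclass R) E F (g : {linear E -> R[i]}) (P : E -> F) :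
  normed_ideal k.+1 A -> continuous g -> A E F P ->
  up_class k.+1 A E F (mulfunctional g P) /\
  inorm (up_class k.+1 A) (mulfunctional g P) <= expR 1 * opnorm g * inorm A P.
Proof.
move=> Aid gc AP; have Pc := ideal_cpoly Aid AP; have nP := inorm_ge0 Aid AP.
have og := opnorm_ge0 gc.
apply: up_classI; first by rewrite !mulr_ge0 ?expR_ge0.
  exact: cpoly_mulfunctional.
move=> a.
have -> : polder k.+1 (mulfunctional g P) a = k.+2%:R^-1 *:
    (g a *: P + k.+1%:R *: (fun x => polder k P (g x *: a) x)).
  by apply/funext => x; rewrite polder_mulfunctional // -polderZ.
have [|||||h1 h2] := ideal_polder_comp Aid (T := idfun) (U := fun x => g x *: a)
    (u := opnorm g * rnorm a) _ _ _ _ _ AP.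
- by [].
- by move=> c x y; rewrite linearP scalerDl scalerA.
- by rewrite mulr_ge0 ?rnorm_ge0.
- by [].
- by move=> x; rewrite rnormZ mulrAC ler_wpM2r ?rnorm_ge0 // le_opnorm.
have h3 := idealZ Aid (g a) AP; have h4 := idealZ Aid k.+1%:R h1.
split; first by apply: (idealZ Aid); exact: (idealD Aid).
rewrite (inormZ Aid); last exact: (idealD Aid).
rewrite rnormV rnorm_nat ler_pdivrMl ?ltr0n //.
apply: (le_trans (ler_inormD Aid h3 h4)); rewrite !(inormZ Aid) // rnorm_nat.
set X := expR 1 * opnorm g * inorm A P * rnorm a.
have X1 : rnorm (g a) * inorm A P <= X.
  apply: (@le_trans _ _ (opnorm g * rnorm a * inorm A P)).
    by rewrite ler_wpM2r // le_opnorm.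
  rewrite /X -!mulrA (mulrC (rnorm a)) ler_peMl ?expr1_ge1 //.
  by rewrite !mulr_ge0 ?rnorm_ge0.
have X2 : inorm A (fun x => polder k P (g x *: a) x) <= X.
  by apply: (le_trans h2); rewrite /X -!mulrA (mulrC (rnorm a)).
by rewrite -[k.+2]add1n natrD mulrDl mul1r lerD // ler_wpM2l.
Qed.

End UpClass.

(** * Lowering the degree *)

Section DownClass.
Variable R : realType.
Local Notation banach := (completeNormedModType R[i]).
Implicit Types E F : banach.

Definition timesvar E F (P : E -> F) : (E * R[i])%type -> F :=
  fun p => p.2 *: P p.1.

Definition monomial_norm (k : nat) (A : polyclass R) : R :=
  inorm A (timesvar (fun z : R[i] => z ^+ k)).

Definition down_class (k : nat) (A : polyclass R) : polyclass R :=
  PolyClass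
    (fun E F => [set P | cpoly k P /\ A (E * R[i])%type F (timesvar P)])
    (fun E F P => inorm A (timesvar P) / monomial_norm k A).

Lemma timesvar_linear E F a (P Q : E -> F) :
  timesvar (a *: P + Q) = a *: timesvar P + timesvar Q.
Proof.
apply/funext => p; rewrite -[LHS]/(p.2 *: (a *: P p.1 + Q p.1)).
by rewrite scalerDr scalerA mulrC -scalerA.
Qed.

Lemma timesvar_eq0 E F (P : E -> F) : timesvar P = 0 -> P = 0.
Proof.
move=> P0; apply/funext => x; have := congr1 (fun f => f (x, 1)) P0.
by rewrite /timesvar /= scale1r.
Qed.

Lemma timesvar0 E F : timesvar (0 : E -> F) = 0.
Proof. by apply/funext => p; exact: scaler0. Qed.

Section Ideal.
Variables (k : nat) (A : polyclass R).
Hypothesis Aid : normed_ideal k.+1 A.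

(** The monomial w z^k is the polar form of z^(k+1) at (w, z, ..., z), whence the bound e. Its
    restriction to the diagonal is z^(k+1), and z |-> (z, z) has norm 1 for the maximum norm, whence
    the bound 1. *)
Lemma ideal_monomial : A (R[i] * R[i])%type R[i] (timesvar (fun z : R[i] => z ^+ k)) /\
  1 <= monomial_norm k A <= expR 1.
Proof.
have [_ _ [Az nz]] := Aid; have zc := ideal_cpoly Aid Az.
have E : timesvar (fun z : R[i] => z ^+ k) =
    fun p : (R[i] * R[i])%type => polder k (fun z : R[i] => z ^+ k.+1) p.2 p.1.
  by apply/funext => p; rewrite polder_expr.
have [|||||h1 h2] := @ideal_polder_comp _ _ _ Aid (R[i] * R[i])%type R[i] R[i]
  (fun p => p.1) (fun p => p.2) _ 1 _ _ _ _ _ Az.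
- by [].
- by [].
- by [].
- exact: rnorm_fst.
- by move=> p; rewrite mul1r; exact: rnorm_snd.
rewrite -E nz !mulr1 in h1 h2; split; first exact: h1.
rewrite h2 andbT; have dl : linear (fun z : R[i] => (z, z)) by [].
have [|_] := ideal_precomp Aid (t := 1) dl ler01 _ h1.
  by move=> z; rewrite rnorm_pair maxxx mul1r.
rewrite expr1n mulr1 (_ : _ \o _ = (fun z : R[i] => z ^+ k.+1)) ?nz //.
by apply/funext => z; rewrite /timesvar /= exprS.
Qed.

Lemma monomial_norm_gt0 : 0 < monomial_norm k A.
Proof. by have [_ /andP[h _]] := ideal_monomial; exact: lt_le_trans h. Qed.

(** Leaving the variable z alone would cost max(|T|, 1)^(k+1). Scaling it by |T| balances the two
    coordinates, and dividing the result by |T| leaves exactly |T|^k. When |T| = 0, k > 0 gives P(0)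
    = 0 and the composition vanishes. *)
Lemma down_comp E1 E F F1 (T : {linear E1 -> E}) (P : E -> F) (S : {linear F -> F1}) :
  (0 < k)%N -> continuous T -> continuous S -> down_class k A E F P ->
  down_class k A E1 F1 (S \o P \o T) /\
  inorm (down_class k A) (S \o P \o T) <=
    opnorm S * inorm (down_class k A) P * opnorm T ^+ k.
Proof.
move=> k0 Tc Sc [Pc AP]; have m0 := monomial_norm_gt0.
have oT := opnorm_ge0 Tc; have oS := opnorm_ge0 Sc; have nP := inorm_ge0 Aid AP.
rewrite /= mulrA -[_ / _ * _]mulrAC -(mulrA (opnorm S)) ler_pM2r ?invr_gt0 //.
suff [h1 h2] : A (E1 * R[i])%type F1 (timesvar (S \o P \o T)) /\
    inorm A (timesvar (S \o P \o T)) <= opnorm S * (inorm A (timesvar P) * opnorm T ^+ k).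
  by split=> //; split=> //; exact: cpoly_comp.
have [T0|T0] := eqVneq (opnorm T) 0.
  have -> : S \o P \o T = 0.
    apply/funext => x /=; have /eqP : rnorm (T x) = 0.
      apply/eqP; rewrite eq_le rnorm_ge0 andbT.
      by rewrite (le_trans (le_opnorm x Tc)) // T0 mul0r.
    rewrite rnorm_eq0 => /eqP ->; move: Pc; rewrite -(prednK k0) => Pc.
    by rewrite (cpoly_at0 Pc) linear0.
  rewrite timesvar0 (inorm0 Aid); split; first exact: (ideal0 Aid).
  by rewrite !mulr_ge0 ?exprn_ge0.
set t := opnorm T in oT T0 *; have tp : 0 < t by rewrite lt_def T0.
have tC : t%:C%C != 0 by rewrite (inj_eq (@complexI _)).
pose L (p : (E1 * R[i])%type) : (E * R[i])%type := (T p.1, t%:C%C * p.2).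
have Ll : linear L.
  move=> a p q; rewrite /L /= linearP mulrDr; congr (_, _).
  by rewrite -[a *: p.2]/(a * p.2) mulrCA.
have Lt p : rnorm (L p) <= t * rnorm p.
  rewrite rnorm_pair ge_max /= rnormM rnorm_real gtr0_norm //.
  rewrite (le_trans (le_opnorm _ Tc)) ?ler_wpM2l ?rnorm_fst ?rnorm_snd //.
have [h1 h2] := ideal_comp Aid Ll (linearP S) oT oS Lt (fun y => le_opnorm y Sc) AP.
have -> : timesvar (S \o P \o T) = t%:C%C^-1 *: (S \o timesvar P \o L).
  apply/funext => p; rewrite [RHS]/GRing.scale /= /timesvar /= linearZ scalerA.
  by rewrite mulrA mulVf // mul1r.
rewrite (inormZ Aid) // rnormV rnorm_real gtr0_norm //.
split; first exact: (idealZ Aid).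
rewrite ler_pdivrMl // (le_trans h2) // exprS.
by rewrite [leRHS](_ : _ = opnorm S * inorm A (timesvar P) * (t * t ^+ k)) //; ring.
Qed.

Lemma normed_ideal_down : (0 < k)%N -> normed_ideal k (down_class k A).
Proof.
move=> k0; have m0 := monomial_norm_gt0.
split.
- move=> E F; split.
  + by move=> P [].
  + by split; [exact: cpoly0|rewrite timesvar0; exact: (ideal0 Aid)].
  + move=> a P Q [Pc AP] [Qc AQ]; split; first exact: cpoly_linear.
    by rewrite timesvar_linear; exact: (ideal_lin Aid).
  have tZ a (P : E -> F) : timesvar (a *: P) = a *: timesvar P.
    by rewrite -[a *: P]addr0 timesvar_linear timesvar0 addr0.
  split.
  + by move=> P [_ AP]; apply: divr_ge0 (ltW m0); exact: (inorm_ge0 Aid).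
  + move=> P [_ AP] /= /eqP; rewrite mulf_eq0 invr_eq0 (gt_eqF m0) orbF.
    by move=> /eqP/(inorm_eq0 Aid AP)/timesvar_eq0.
  + by move=> a P [_ AP] /=; rewrite tZ (inormZ Aid) // mulrA.
  + move=> P Q [_ AP] [_ AQ] /=; rewrite -mulrDl ler_pM2r ?invr_gt0 //.
    by rewrite -[P]scale1r timesvar_linear !scale1r; exact: (ler_inormD Aid).
- by move=> E1 E F F1 T P S Tc Sc DP; exact: down_comp.
- have [h _] := ideal_monomial; have [_ _ [Az _]] := Aid.
  have zc := ideal_cpoly Aid Az; have := cpoly_polder (1 : R[i]) zc.
  rewrite polder_expr // scale1r => zk; split; first by split.
  by rewrite /= divff // gt_eqF.
Qed.

(** z P_a(x) is the polar form of P at (z a, x, ..., x), so the basic bound applies with U (x, z) =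
    z a; dividing by a monomial norm that is at least 1 keeps it. *)
Lemma down_polder E F (P : E -> F) a : A E F P ->
  down_class k A E F (polder k P a) /\
  inorm (down_class k A) (polder k P a) <= expR 1 * inorm A P * rnorm a.
Proof.
move=> AP; have Pc := ideal_cpoly Aid AP; have nP := inorm_ge0 Aid AP.
have E1 : timesvar (polder k P a) = fun p => polder k P (p.2 *: a) p.1.
  by apply/funext => p; rewrite polderZ.
have [|||||h1 h2] := @ideal_polder_comp _ _ _ Aid (E * R[i])%type E F
  (fun p => p.1) (fun p => p.2 *: a) _ (rnorm a) _ _ _ _ _ AP.
- by [].
- by move=> c p q; rewrite scalerDl scalerA.
- exact: rnorm_ge0.
- exact: rnorm_fst.
- by move=> p; rewrite rnormZ mulrC ler_wpM2l ?rnorm_ge0 // rnorm_snd.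
rewrite -E1 in h1 h2; split; first by split; [exact: cpoly_polder|].
have [_ /andP[m1 _]] := ideal_monomial.
rewrite /= ler_pdivrMr ?monomial_norm_gt0 //; apply: (le_trans h2).
rewrite (mulrC (rnorm a)) mulrA ler_peMr // !mulr_ge0 ?expR_ge0 ?rnorm_ge0 //.
Qed.

(** Composition with x |-> (x, g(x)/|g|) costs only |g|. The factor e pays for the division by the
    monomial norm, which is at most e. *)
Lemma down_mulfunctional E F (g : {linear E -> R[i]}) (P : E -> F) :
  continuous g -> down_class k A E F P ->
  A E F (mulfunctional g P) /\
  inorm A (mulfunctional g P) <= expR 1 * opnorm g * inorm (down_class k A) P.
Proof.
move=> gc [Pc AP]; have nP := inorm_ge0 Aid AP; have m0 := monomial_norm_gt0.
have og := opnorm_ge0 gc.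
have [g0|g0] := eqVneq (opnorm g) 0.
  have -> : mulfunctional g P = 0.
    apply/funext => x; have /eqP : rnorm (g x) = 0.
      apply/eqP; rewrite eq_le rnorm_ge0 andbT.
      by rewrite (le_trans (le_opnorm x gc)) // g0 mul0r.
    by rewrite rnorm_eq0 /mulfunctional => /eqP ->; rewrite scale0r.
  rewrite (inorm0 Aid) g0 mulr0 mul0r; split=> //; exact: (ideal0 Aid).
set c := opnorm g in og g0 *; have cp : 0 < c by rewrite lt_def g0.
have cC : c%:C%C != 0 by rewrite (inj_eq (@complexI _)).
pose L (x : E) : (E * R[i])%type := (x, c%:C%C^-1 * g x).
have Ll : linear L.
  move=> a x y; rewrite /L linearP mulrDr; congr (_, _).
  by rewrite -[a *: g x]/(a * g x) mulrCA.
have Lt x : rnorm (L x) <= 1 * rnorm x.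
  rewrite rnorm_pair ge_max /= mul1r lexx rnormM rnormV rnorm_real gtr0_norm //.
  by rewrite ler_pdivrMl // le_opnorm.
have [h1 h2] := ideal_precomp Aid Ll ler01 Lt AP.
have -> : mulfunctional g P = c%:C%C *: (timesvar P \o L).
  apply/funext => x; rewrite [RHS]/GRing.scale /= /timesvar /= scalerA.
  by rewrite mulrA mulfV // mul1r.
rewrite (inormZ Aid) // rnorm_real gtr0_norm //; split; first exact: (idealZ Aid).
rewrite expr1n mulr1 in h2.
apply: (le_trans (ler_wpM2l og h2)); rewrite /= mulrA ler_pdivlMr //.
have [_ /andP[_ me]] := ideal_monomial.
by rewrite [leLHS]mulrC mulrA ler_wpM2r // ler_wpM2r.
Qed.

End Ideal.
End DownClass.

(** * Uniqueness below the given degree, up to equivalent norms *)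

Section Uniqueness.
Variable R : realType.
Local Notation banach := (completeNormedModType R[i]).
Implicit Types A B : polyclass R.

(** The one-sided half of [equivalent_ideal]: the inclusion and its constant descend together from
    degree k+1 to degree k. *)
Definition dominated_ideal A B : Prop := exists2 d : R, 0 < d &
  forall (E F : banach) (P : E -> F), A E F P ->
    B E F P /\ inorm B P <= d * inorm A P.

Lemma same_ideal_dominated A B An : same_ideal A An -> same_ideal B An ->
  dominated_ideal A B.
Proof.
move=> sA sB; exists 1 => // E F P AP.
have [eA nA] := sA E F; have [eB nB] := sB E F.
have AnP : An E F P by rewrite -eA.
have BP : B E F P by rewrite eB.
by rewrite mul1r nB // nA.
Qed.

Lemma dominated_equivalent A B :
  dominated_ideal A B -> dominated_ideal B A -> equivalent_ideal A B.
Proof.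
move=> [d d0 dP] [c c0 cP]; split.
  by move=> E F; apply/seteqP; split=> P h; [have [] := dP _ _ _ h|have [] := cP _ _ _ h].
exists c^-1, d; split; rewrite ?invr_gt0 // => E F P AP.
have [BP h1] := dP _ _ _ AP; have [_ h2] := cP _ _ _ BP.
by rewrite h1 andbT ler_pdivrMl.
Qed.

Lemma polder_timesvar k (E F : banach) (P : E -> F) x :
  cpoly k.+1 (timesvar P) ->
  polder k (timesvar P) (0, 1) (x, 0) = k.+1%:R^-1 *: P x.
Proof.
move=> Pc; have h := coef01X (coef01_cst (P x) (ltn0Sn 0)).
apply: (polder_coef01 Pc (eq_coef01 h _ erefl erefl)) => t.
by rewrite /timesvar /= scaler0 addr0 add0r [t *: 1]mulr1.
Qed.

(* A member P of degree k reappears, up to a factor, as the derivative in the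
   direction (0, 1) of the polynomial (x, z) |-> z P(x) of degree k+1. *)
Lemma dominated_pred (N : option nat) (A B : nat -> polyclass R) k :
  coherent N A -> coherent N B -> index_in N k -> index_in N k.+1 ->
  dominated_ideal (A k.+1) (B k.+1) -> dominated_ideal (A k) (B k).
Proof.
move=> [_ [D [_ D0 [Aid _ AD]]]] [C [_ [C0 _ [Bid BC _]]]] Nk NSk [d d0 dP].
(* [D] is the cost of multiplying by the coordinate z in [A], [d] of passing to [B], [C] of
   differentiating in [B] along a vector of norm 1; k+1 undoes the factor left by the derivative. *)
exists (k.+1%:R * (C * (d * D))); first by rewrite !mulr_gt0.
move=> E F P AP.
have fl : linear (fun p : (E * R[i])%type => p.1) by [].
have [|Af nf] := ideal_precomp (Aid k Nk) fl ler01 _ AP.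
  by move=> p; rewrite mul1r; exact: rnorm_fst.
have sl : linear (fun p : (E * R[i])%type => p.2) by [].
pose g : {linear (E * R[i])%type -> R[i]} :=
  HB.pack (fun p : (E * R[i])%type => p.2) (GRing.isLinear.Build _ _ _ _ _ sl).
have g1 (p : (E * R[i])%type) : rnorm (g p) <= 1 * rnorm p.
  by rewrite mul1r; exact: rnorm_snd.
have gc : continuous g := bounded_continuous sl g1.
have [At nt] := AD k _ _ _ g Nk NSk gc Af.
have nP := inorm_ge0 (Aid k Nk) AP.
have {}nt : inorm (A k.+1) (timesvar P) <= D * inorm (A k) P.
  apply: (le_trans nt); rewrite -mulrA ler_wpM2l ?(ltW D0) //.
  rewrite expr1n mulr1 in nf; apply: le_trans nf; rewrite ler_piMl //.
    exact: inorm_ge0 (Aid k Nk) _ _ _ Af.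
  exact: opnorm_le.
have [Bt nBt] := dP _ _ _ At.
have tc := ideal_cpoly (Bid k.+1 NSk) Bt.
have [Bp np] := BC k _ _ _ ((0, 1) : (E * R[i])%type) Nk NSk Bt.
have il : linear (fun x : E => (x, 0) : (E * R[i])%type).
  move=> a x y; rewrite -[RHS]/(a *: x + y, a *: (0 : R[i]) + 0).
  by rewrite scaler0 addr0.
have [|Bi ni] := ideal_precomp (Bid k Nk) il ler01 _ Bp.
  by move=> x; rewrite rnorm_pair /= rnorm0 mul1r ge_max lexx rnorm_ge0.
have PE : P = k.+1%:R *: (polder k (timesvar P) (0, 1) \o (fun x => (x, 0))).
  apply/funext => x; rewrite -[RHS]/(k.+1%:R *: polder k (timesvar P) (0, 1) (x, 0)).
  by rewrite polder_timesvar // scalerA mulfV ?scale1r // pnatr_eq0.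
rewrite {1 2}PE (inormZ (Bid k Nk)) // rnorm_nat.
split; first exact: (idealZ (Bid k Nk)).
rewrite -mulrA ler_wpM2l //.
rewrite expr1n mulr1 in ni; apply: (le_trans ni); apply: (le_trans np).
rewrite rnorm_pair /= rnorm0 rnorm1 max_r // mulr1 -mulrA ler_wpM2l ?(ltW C0) //.
by apply: (le_trans nBt); rewrite -mulrA ler_wpM2l // ltW.
Qed.

Lemma dominated_below (N : option nat) (A B : nat -> polyclass R) n k :
  coherent N A -> coherent N B -> index_in N n -> (0 < k <= n)%N ->
  dominated_ideal (A n) (B n) -> dominated_ideal (A k) (B k).
Proof.
move=> cA cB Nn /andP[k0 kn].
have Nm m : (0 < m)%N -> (m <= n)%N -> index_in N m.
  move=> m0 mn; rewrite /index_in m0 /=; case: N Nn {cA cB} => //= N'.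
  by move=> /andP[_]; exact: leq_trans.
elim: n kn Nm {Nn} => [|n IH] kn Nm; first by case: k k0 kn.
move: kn; rewrite leq_eqVlt => /orP[/eqP -> //|kn] AB.
apply: IH => // [m m0 mn|]; first by apply: Nm => //; exact: leqW.
by apply: (dominated_pred cA cB _ _ AB); apply: Nm; rewrite // (leq_trans k0).
Qed.

End Uniqueness.

(** * The sequence extending a given ideal in both directions *)

Section Sequence.
Variable R : realType.
Implicit Types A : polyclass R.

Fixpoint up_iter n A j : polyclass R :=
  if j is j'.+1 then up_class (n + j') (up_iter n A j') else A.

Fixpoint down_iter n A j : polyclass R :=
  if j is j'.+1 then down_class (n - j'.+1) (down_iter n A j') else A.

(** For n > 0 the sequence is read from index 1 on; the value at 0 carries no meaning. *)
Definition extension n A k : polyclass R :=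
  if (n <= k)%N then up_iter n A (k - n) else down_iter n A (n - k).

Lemma extension_up n A k :
  (n <= k)%N -> extension n A k.+1 = up_class k (extension n A k).
Proof. by move=> nk; rewrite /extension leqW // nk subSn //= subnKC. Qed.

Lemma extension_down n A k :
  (k < n)%N -> extension n A k = down_class k (extension n A k.+1).
Proof.
move=> kn; rewrite /extension leqNgt kn /=.
have -> : down_iter n A (n - k) = down_class k (down_iter n A (n - k.+1)).
  by rewrite -[in LHS](subnSK kn) /= subnSK // subKn // ltnW.
(* At n = k+1 the upward branch is taken for k+1, and both iterations are still at [A]. *)
case: (ltngtP n k.+1) => [|//|->]; last by rewrite subnn.
by rewrite ltnS leqNgt kn.
Qed.

Lemma extension_id n A : extension n A n = A.
Proof. by rewrite /extension leqnn subnn. Qed.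

Lemma extension_ideal n A k : normed_ideal n A -> (0 < k)%N ->
  normed_ideal k (extension n A k).
Proof.
move=> Aid k0; have [nk|kn] := leqP n k.
  rewrite -(subnKC nk); elim: (k - n)%N => [|j IH].
    by rewrite addn0 extension_id.
  by rewrite addnS extension_up ?leq_addr //; exact: normed_ideal_up.
(* Below n the induction runs on the distance to n. *)
move: k0; rewrite -(subKn (ltnW kn)); elim: (n - k)%N => [|j IH] h.
  by rewrite subn0 extension_id.
have jn : (j < n)%N by rewrite -subn_gt0 (leq_trans h) // leq_sub2l.
rewrite extension_down ?ltn_subrL ?(leq_ltn_trans _ jn) //.
by apply: normed_ideal_down => //; rewrite subnSK //; apply: IH; rewrite subn_gt0.
Qed.

(** Each step from k to k+1 lies on one side of n. Above, the derivative estimate holds with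
    constant 1 by construction of the norm and is weakened to e; the other three estimates rest on
    the mixed polar bound. *)
Lemma extension_coherent n A : normed_ideal n A ->
  coherent_with (expR 1) (expR 1) None (extension n A).
Proof.
move=> Aid; have Xid k := @extension_ideal n A k Aid; split.
- by move=> k /andP[k0 _]; exact: Xid.
- move=> k E F P a /andP[k0 _] _; have [nk|kn] := leqP n k.
    rewrite extension_up // => UP; have [Pc AP _] := UP; split; first exact: AP.
    apply: (le_trans (le_inorm_up (Xid k k0) a UP)).
    rewrite -mulrA ler_peMl ?expr1_ge1 // mulr_ge0 ?rnorm_ge0 //.
    exact: inorm_up_ge0 (Xid k k0) _ _ _ UP.
  by rewrite (extension_down _ kn) => AP; apply: down_polder AP; exact: Xid.
- move=> k E F P g /andP[k0 _] _ gc; have [nk|kn] := leqP n k.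
    rewrite extension_up //; move: k0 (Xid k k0).
    by case: k nk => // k _ _ Xk AP; exact: up_mulfunctional.
  by rewrite (extension_down _ kn) => AP; apply: down_mulfunctional => //; exact: Xid.
Qed.

End Sequence.

Theorem theorem3p3 (R : realType) (n : nat) (An : polyclass R) :
  (0 < n)%N -> banach_ideal n An ->
  (exists (A : nat -> polyclass R) (C D : R),
     [/\ same_ideal (A n) An, 1 <= C <= expR 1, 1 <= D <= expR 1 &
         coherent_with C D None A])
  /\
  (forall (N : option nat) (A B : nat -> polyclass R),
     index_in N n ->
     coherent N A -> same_ideal (A n) An ->
     coherent N B -> same_ideal (B n) An ->
     forall k : nat, (0 < k < n)%N -> equivalent_ideal (A k) (B k)).
Proof.
move=> n0 [Aid _]; split.
  exists (extension n An), (expR 1), (expR 1); rewrite expr1_ge1 lexx.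
  by split=> //; [rewrite extension_id|exact: extension_coherent].
move=> N A B Nn cA sA cB sB k /andP[k0 kn].
have kn' : (0 < k <= n)%N by rewrite k0 ltnW.
apply: dominated_equivalent.
  exact: dominated_below cA cB Nn kn' (same_ideal_dominated sA sB).
exact: dominated_below cB cA Nn kn' (same_ideal_dominated sB sA).
Qed.
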